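(* Let $J = \{J_l : 1 \le l \le N\}$ be a partition of $\mathbb{T}$ into finitely many intervals. Suppose that $\alpha \in \mathbb{T}$ is rational. Then, for every $\beta \in \mathbb{T}_w$, $$R(s(\alpha,\beta,\gamma,J)) = T(s(\alpha,\beta,\gamma,J)) = \infty$$ for Lebesgue almost every $\gamma \in \mathbb{T}$. In particular, these equalities hold for Lebesgue almost every $(\beta,\gamma) \in \mathbb{T}^2$.
   Context: $\mathbb{T} = \mathbb{R}/\mathbb{Z}$. $\mathbb{T}_w$ denotes the set of irrational numbers in $\mathbb{T}$ with unbounded partial quotients, i.e. whose continued fraction coefficients are unbounded. For $(\alpha,\beta,\gamma) \in \mathbb{T}^3$, $s(\alpha,\beta,\gamma,J) = (s_n)_{n\in\mathbb{Z}}$ denotes the coding of $\alpha n^2 + \beta n + \gamma$ (in $\mathbb{T}$) with respect to $J$, i.e. $s_n = \sum_{l=1}^N \lambda_l \chi_{J_l}(\alpha n^2 + \beta n + \gamma)$ with distinct numbers $\lambda_1,\ldots,\lambda_N$. For a two-sided sequence $\omega = (\omega_k)_{k\in\mathbb{Z}}$ over a finite alphabet and $n \ge 1$, let $R_n(\omega) = 1 + \frac{1}{n} \sup \{ m : \omega_k = \omega_{k+n} \text{ for } 1 \le k \le m \}$ and $T_n(\omega) = 1 + \frac{1}{n} \sup \{ m : \omega_k = \omega_{k+n} \text{ and } \omega_{n+1-k} = \omega_{1-k} \text{ for } 1 \le k \le m \}$, where $m$ ranges over positive integers and $\sup\emptyset = 0$; set $R(\omega) = \limsup_{n\to\infty}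 R_n(\omega)$ and $T(\omega) = \limsup_{n\to\infty} T_n(\omega)$, elements of $[1,\infty]$. *)

(* Defs.v *)
From HB Require Import structures.
From mathcomp Require Import all_boot all_order all_algebra.
From mathcomp Require Import all_classical all_reals all_analysis.

Set Implicit Arguments.
Unset Strict Implicit.
Unset Printing Implicit Defensive.

Import Order.TTheory GRing.Theory Num.Theory.
Import numFieldNormedType.Exports.

Local Open Scope classical_set_scope.
Local Open Scope ring_scope.

(* The torus R/Z is represented by its fundamental
   domain [0, 1[, and the quotient map R -> R/Z by the fractional part;
   Lebesgue measure on R/Z is Lebesgue measure on [0, 1[. *)
Definition circle (R : realType) : set R := `[0, 1[%classic.

Definition modZ (R : realType) (x : R) : R := x - (Num.floor x)%:~R.

(* The intervals (arcs) of R/Z are the images of the intervals of R under the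
   quotient map, whatever the nature of the endpoints; in terms of
   representatives, an arc may thus wrap around 0. *)
Definition circle_arc (R : realType) (A : set R) : Prop :=
  exists I : interval R, A = @modZ R @` [set` I].

(* x = [a_0; a_1, a_2, ...] with a_n = floor x_n, where x_0 = x and
   x_(n+1) = 1 / (x_n - a_n).  On a rational x the recursion eventually divides
   by 0 and the values are junk: only irrational x are of interest. *)
Definition complete_quotient (R : realType) (x : R) (n : nat) : R :=
  iter n (fun y : R => (modZ y)^-1) x.

Definition partial_quotient (R : realType) (x : R) (n : nat) : int :=
  Num.floor (complete_quotient x n).

Definition unbounded_quotients (R : realType) : set R :=
  [set x | [/\ circle x, irrational x &
     forall M : int, exists n : nat, (M < partial_quotient x n)%R]].

Definition coding (R : realType) (N : nat) (J : 'I_N -> set R)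
    (lambda : 'I_N -> R) (alpha beta gamma : R) (n : int) : R :=
  \sum_(l < N)
    lambda l * \1_(J l) (modZ (alpha * n%:~R ^+ 2 + beta * n%:~R + gamma)).

(* Supremum of a set of naturals with values in [0, +oo], so sup set0 = 0
   (whereas ereal_sup set0 = -oo). *)
Definition esup_nat (R : realType) (A : set nat) : \bar R :=
  maxe 0%E (ereal_sup [set (m%:R)%:E | m in A]).

Definition rep_n (R : realType) (V : Type) (w : int -> V) (n : nat) : \bar R :=
  (1 + (n%:R^-1)%:E * esup_nat R
     [set m : nat | (0 < m)%N /\
        forall k : nat, (1 <= k <= m)%N -> w k%:Z = w (k%:Z + n%:Z)%R])%E.

Definition tworep_n (R : realType) (V : Type) (w : int -> V) (n : nat) :
    \bar R :=
  (1 + (n%:R^-1)%:E * esup_nat R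
     [set m : nat | (0 < m)%N /\
        forall k : nat, (1 <= k <= m)%N ->
          w k%:Z = w (k%:Z + n%:Z)%R /\
          w (n%:Z + 1 - k%:Z)%R = w (1 - k%:Z)%R])%E.

(* The value at n = 0 is irrelevant for the limsup. *)
Definition rep (R : realType) (V : Type) (w : int -> V) : \bar R :=
  limn_esup (rep_n R w).

Definition tworep (R : realType) (V : Type) (w : int -> V) : \bar R :=
  limn_esup (tworep_n R w).

(* Main.v *)
Require Import Defs.
From HB Require Import structures.
From mathcomp Require Import all_boot all_order all_algebra.
From mathcomp Require Import all_classical all_reals all_analysis.
From mathcomp Require Import measurable_realfun.
From mathcomp Require Import ring lra zify.

Set Implicit Arguments.
Unset Strict Implicit.
Unset Printing Implicit Defensive.

Import Order.TTheory GRing.Theory Num.Theory.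
Import numFieldNormedType.Exports.

Local Open Scope classical_set_scope.
Local Open Scope ring_scope.

(** Write alpha = a / q.  If q divides n, then replacing j by j + n moves
    alpha j^2 + beta j + gamma by n beta modulo 1, since
    alpha (2 j n + n^2) is an integer.  So the coding at j and at j + n can
    differ only if the orbit point at j lies within d = |n beta - p| of an
    endpoint of one of the arcs, p being any integer.  For |j| <= L n this
    excludes a set of gamma of measure O(L n d).

    Call beta well approximable if n |n beta - p| takes arbitrarily small
    values.  Multiplying n by a bounded factor keeps this small, so n may be
    chosen to be a multiple of q beyond any bound, and then O(L n d) tends to 0
    for fixed L.  Hence the gamma for which the window |j| <= L n fails for all
    large admissible n form a null set.  A countable union over L leaves a null
    set outside which, for every L, arbitrarily large n satisfy s_j = s_(j+n)
    whenever |j| <= L n.  The indices 1 <= j <= L n give the repetitions, and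
    the indices 1 - L n <= j <= 0 give the backward repetitions as well, so
    both exponents are infinite.

    It remains to see which beta are well approximable.  If the partial
    quotients are unbounded, the convergents show it: the denominator Q of a
    convergent satisfies Q |Q beta - P| < 1 / y with y the next complete
    quotient ([unbounded_quotients_well_approximable]).  That almost every beta
    is well approximable follows from the Lebesgue density theorem: by
    Dirichlet's theorem, around a beta with n |n beta - p| >= eps for all n, p
    the forbidden intervals about fractions p / n occupy a fixed proportion of
    arbitrarily small balls ([badly_approximable_thin]).  The statement about
    pairs is then Fubini's theorem for a measurable set of exceptional pairs
    almost all of whose sections are null. *)

(** * Well approximable numbers and continued fractions *)

(** The inequality is required for a single n only: large n and divisibility
    conditions on n come for free ([well_approximable_multiples]). *)
Definition well_approximable (R : realType) : set R :=
  [set x | forall eps : R, 0 < eps -> exists (n : nat) (p : int),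
     n.+1%:R * `|n.+1%:R * x - p%:~R| < eps].

Lemma modZ_ge0 (R : realType) (x : R) : 0 <= modZ x.
Proof. by rewrite subr_ge0 floor_le. Qed.

Lemma modZ_lt1 (R : realType) (x : R) : modZ x < 1.
Proof. by have := floorD1_gt x; rewrite /modZ intrD ltrBlDr addrC. Qed.

Lemma irrational_modZV (R : realType) (x : R) :
  irrational x -> irrational (modZ x)^-1.
Proof.
move=> xirr [r _ rx]; apply: xirr; exists (r^-1 + (Num.floor x)%:~R) => //.
by rewrite raddfD /= fmorphV/= rx invrK ratr_int /modZ subrK.
Qed.

Lemma irrational_modZV_gt1 (R : realType) (x : R) :
  irrational x -> 1 < (modZ x)^-1.
Proof.
move=> xirr; rewrite -[X in X < _]invr1 ltf_pV2 ?posrE ?modZ_lt1//.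
rewrite lt_def modZ_ge0 andbT; apply/eqP => x0.
apply: (irrational_modZV xirr); rewrite x0 invr0.
by exists 0 => //; rewrite rmorph0.
Qed.

(** P / Q and P' / Q' are consecutive convergents: writing y for the complete
    quotient, x = (y P + P') / (y Q + Q'), and the Moebius transformation has
    determinant 1 or -1.  The next step substitutes y = a + 1 / z, which
    replaces (Q, Q') by (a Q + Q', Q). *)
Lemma complete_quotient_convergents (R : realType) (x : R) (n : nat) :
  irrational x ->
  [/\ irrational (complete_quotient x n.+1), 1 < complete_quotient x n.+1 &
   exists (Q Q' : nat) (P P' : int),
     [/\ (0 < Q)%N, `|P%:~R * Q'%:R - P'%:~R * Q%:R : R| = 1 &
         x * (complete_quotient x n.+1 * Q%:R + Q'%:R) =
         complete_quotient x n.+1 * P%:~R + P'%:~R]].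
Proof.
move=> xirr; elim: n => [|n].
  set y := complete_quotient x 1.
  have y1 : 1 < y := irrational_modZV_gt1 xirr.
  split; [exact: irrational_modZV|by []|].
  exists 1%N, 0%N, (Num.floor x), 1; split => //.
    by rewrite mulr0 mulr1 sub0r normrN normr1.
  have y0 : y != 0 by rewrite gt_eqF// (lt_trans _ y1).
  have xE : x = y^-1 + (Num.floor x)%:~R.
    by rewrite /y /complete_quotient /= invrK /modZ subrK.
  by rewrite [X in X * (_ + _)]xE; field.
set y := complete_quotient x n.+1.
move=> [yirr y1 [Q [Q' [P [P' [Q0 det yx]]]]]].
set z := complete_quotient x n.+2.
have z1 : 1 < z := irrational_modZV_gt1 yirr.
split; [exact: irrational_modZV|by []|].
have a1 : 1 <= Num.floor y by rewrite floor_ge_int; exact: ltW.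
have aE : (`|Num.floor y|%N%:R : R) = (Num.floor y)%:~R.
  by rewrite natr_absz ger0_norm// (le_trans _ a1).
exists (`|Num.floor y| * Q + Q')%N, Q, (Num.floor y * P + P'), P; split => //.
- by rewrite addn_gt0 muln_gt0 Q0 absz_gt0 gt_eqF// (lt_le_trans _ a1).
- rewrite -[RHS]det -[RHS]normrN natrD natrM aE intrD intrM; congr `|_|; ring.
- have z0 : z != 0 by rewrite gt_eqF// (lt_trans _ z1).
  have yE : y = z^-1 + (Num.floor y)%:~R by rewrite invrK /modZ subrK.
  rewrite natrD natrM aE intrD intrM.
  have -> : z * ((Num.floor y)%:~R * Q%:R + Q'%:R) + Q%:R
     = z * (y * Q%:R + Q'%:R) by rewrite {2}yE; field.
  have -> : z * ((Num.floor y)%:~R * P%:~R + P'%:~R) + P%:~R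
     = z * (y * P%:~R + P'%:~R) by rewrite {2}yE; field.
  by rewrite mulrCA yx.
Qed.

(** Solving x = (y P + P') / (y Q + Q') gives
    |Q x - P| = 1 / (y Q + Q') <= 1 / (y Q), and y is at least the partial
    quotient. *)
Lemma unbounded_quotients_well_approximable (R : realType) :
  @unbounded_quotients R `<=` @well_approximable R.
Proof.
move=> x [/= xc xirr xub] eps eps0.
have [n] := xub (Num.ceil eps^-1).
case: n => [|n].
  rewrite /partial_quotient /complete_quotient /=.
  have -> : Num.floor x = 0.
    by apply/eqP; rewrite floor_eq add0r; move: xc; rewrite /circle /= in_itv/=.
  have : 0 <= Num.ceil eps^-1.
    by rewrite ceil_ge0 (lt_trans (ltrN10 _))// invr_gt0.
  by rewrite leNgt => /negP.
have [yirr y1 [Q [Q' [P [P' [Q0 det yx]]]]]] :=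
  complete_quotient_convergents n xirr.
rewrite /partial_quotient; set y := complete_quotient x n.+1 in yirr y1 yx *.
move=> ya.
have epsy : eps^-1 < y.
  apply: (le_lt_trans (ceil_ge _)); apply: lt_le_trans (floor_le y).
  by rewrite ltr_int.
exists Q.-1, P; rewrite prednK//.
have Qr : 0 < Q%:R :> R by rewrite ltr0n.
have y0 : 0 < y by exact: lt_trans y1.
have yQ : 0 < y * Q%:R by exact: mulr_gt0.
have D0 : 0 < y * Q%:R + Q'%:R by rewrite ltr_wpDr.
have -> : Q%:R * x - P%:~R
    = - (P%:~R * Q'%:R - P'%:~R * Q%:R) / (y * Q%:R + Q'%:R).
  apply: (mulIf (lt0r_neq0 D0)); rewrite divfK ?lt0r_neq0//.
  rewrite mulrBl -mulrA yx; ring.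
rewrite normrM normrN det mul1r normfV (gtr0_norm D0).
rewrite ltr_pdivrMr//.
apply: (@lt_le_trans _ _ (eps * (y * Q%:R))).
  rewrite mulrA -[ltLHS]mul1r ltr_pM2r//.
  by rewrite -ltr_pdivrMl// mulr1.
by rewrite ler_pM2l// lerDl.
Qed.

(** * Almost every number is well approximable *)

(** Pigeonhole: two of the N + 2 fractional parts of k x, for
    0 <= k <= N + 1, fall into the same of N + 1 boxes of length
    1 / (N + 1). *)
Lemma dirichlet_approximation (R : realType) (x : R) (N : nat) :
  exists (n : nat) (p : int), (n <= N)%N /\
    `|n.+1%:R * x - p%:~R| < N.+1%:R^-1.
Proof.
pose f (k : 'I_N.+2) : 'I_N.+1 :=
  inord (Num.truncn (modZ (k%:R * x) * N.+1%:R)).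
have N0 : 0 < N.+1%:R :> R by rewrite ltr0n.
have fE k : (f k)%:R <= modZ (k%:R * x) * N.+1%:R < (f k).+1%:R.
  rewrite /f inordK ?truncn_itv ?mulr_ge0 ?modZ_ge0//.
  by rewrite truncn_lt_nat ?mulr_ge0 ?modZ_ge0// gtr_pMl// modZ_lt1.
have /injectivePn[i [j ij fij]] : ~~ injectiveb f.
  apply/negP => /injectiveP /leq_card; by rewrite !card_ord ltnn.
wlog : i j ij fij / (i < j)%N => [wl|lt_ij].
  have [ij'|ji|/ord_inj/eqP e] := ltngtP i j; first exact: (wl i j).
  - by apply: (wl j i) => //; rewrite eq_sym.
  - by rewrite e in ij.
exists (j - i).-1%N, (Num.floor (j%:R * x) - Num.floor (i%:R * x)).
rewrite prednK ?subn_gt0//; split.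
  by rewrite -ltnS prednK ?subn_gt0// (leq_trans (leq_subr _ _))// -ltnS.
have -> : (j - i)%:R * x - (Num.floor (j%:R * x) - Num.floor (i%:R * x))%:~R
   = modZ (j%:R * x) - modZ (i%:R * x).
  rewrite natrB ?(ltnW lt_ij)// intrB /modZ; ring.
have := fE i; have := fE j; rewrite -fij -!(natr1 (f i)).
set a := (f i)%:R; set u := modZ _; set v := modZ _.
move=> /andP[u1 u2] /andP[v1 v2].
rewrite -(ltr_pM2r N0) mulVf ?gt_eqF// -[X in _ * X](gtr0_norm N0) -normrM.
by rewrite ltr_norml mulrBl; apply/andP; split; lra.
Qed.

Definition badly_approximable (R : realType) (eps : R) : set R :=
  [set x | forall (n : nat) (p : int),
     eps <= n.+1%:R * `|n.+1%:R * x - p%:~R|].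

Lemma ball_rationalE (R : realType) (eps x : R) (n : nat) (p : int) :
  ball (p%:~R / n.+1%:R : R) (eps / n.+1%:R ^+ 2) x <->
  n.+1%:R * `|n.+1%:R * x - p%:~R| < eps.
Proof.
have n0 : 0 < n.+1%:R :> R by rewrite ltr0n.
rewrite /ball /= ltr_pdivlMr ?exprn_gt0//.
suff -> : `|p%:~R / n.+1%:R - x| * n.+1%:R ^+ 2 =
  n.+1%:R * `|n.+1%:R * x - p%:~R| by [].
rewrite distrC expr2 mulrA -[X in _ * X * _](gtr0_norm n0) -normrM mulrBl.
by rewrite divfK ?gt_eqF// mulrC (mulrC x).
Qed.

Lemma measurable_badly_approximable (R : realType) (eps : R) :
  measurable (badly_approximable eps).
Proof.
have -> : badly_approximable eps = ~` \bigcup_(z : nat * int)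
    ball (z.2%:~R / z.1.+1%:R : R) (eps / z.1.+1%:R ^+ 2).
  apply/seteqP; split=> [x bx [[n p] _]|x bx n p].
    by move/ball_rationalE => /=; rewrite ltNge bx.
  rewrite leNgt; apply/negP => h; apply: bx; exists (n, p) => //.
  by apply/ball_rationalE.
apply: measurableC; apply: countable_bigcupT_measurable => // z.
exact: measurable_ball.
Qed.

(** No point of density: take p / n from Dirichlet's theorem at level N.  The
    ball of radius s = eps / n^2 about p / n contains no badly approximable
    number, and it lies in the ball about x of radius r = |p / n - x| + s.
    Since x is badly approximable, n >= eps (N + 1), so r is small with 1 / N;
    since n <= N + 1, s is at least the proportion eps / (1 + eps) of r. *)
Lemma badly_approximable_thin (R : realType) (eps x d : R) :
  0 < eps -> badly_approximable eps x -> 0 < d ->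
  exists2 r : R, 0 < r < d &
    (lebesgue_measure (badly_approximable eps `&` ball x r) <=
     ((1 + eps)^-1 * (r *+ 2))%:E)%E.
Proof.
move=> eps0 bx d0.
(* This level makes eps * r <= 2 / (N + 1) < eps * d below. *)
pose N := Num.truncn (2 / (eps * d)).
have [n [p [nN np]]] := dirichlet_approximation x N.
have n0 : 0 < n.+1%:R :> R by rewrite ltr0n.
have N0 : 0 < N.+1%:R :> R by rewrite ltr0n.
have nN' : n.+1%:R <= N.+1%:R :> R by rewrite ler_nat ltnS.
have NE : 2 / (eps * d) < N.+1%:R.
  by have /andP[] := truncn_itv (ltW (divr_gt0 (ltr0n _ 2) (mulr_gt0 eps0 d0))).
have N1 : 1 <= N.+1%:R :> R by rewrite ler1n.
pose c : R := p%:~R / n.+1%:R; pose s := eps / n.+1%:R ^+ 2.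
have s0 : 0 < s by rewrite divr_gt0 ?exprn_gt0.
have cx : `|c - x| = `|n.+1%:R * x - p%:~R| / n.+1%:R.
  rewrite distrC -[X in _ / X](gtr0_norm n0) -normfV -normrM mulrBl.
  by rewrite mulrAC mulfV ?gt_eqF// mul1r.
have nlow : eps * N.+1%:R <= n.+1%:R.
  rewrite -ler_pdivlMr//; apply: (le_trans (bx n p)).
  by rewrite ler_pM2l// ltW.
have cxs : `|c - x| <= n.+1%:R^-1 * N.+1%:R^-1.
  by rewrite cx mulrC ler_pM2l ?invr_gt0// ltW.
pose r := `|c - x| + s.
have r0 : 0 < r by rewrite ltr_wpDl.
have ba : N.+1%:R^-1 <= n.+1%:R^-1 :> R by rewrite lef_pV2 ?posrE.
have ab : n.+1%:R^-1 <= N.+1%:R^-1 / eps :> R.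
  by rewrite -invfM mulrC lef_pV2 ?posrE ?mulr_gt0// mulrC.
have bd : 2 * N.+1%:R^-1 < eps * d.
  by rewrite ltr_pdivrMr// -ltr_pdivrMl ?mulr_gt0// mulrC.
have b1 : N.+1%:R^-1 <= 1 :> R by rewrite invf_le1.
have sE : s = eps * n.+1%:R^-1 ^+ 2 by rewrite /s exprVn.
have epsr : eps * r <= 2 * N.+1%:R^-1.
  have a0 : 0 < n.+1%:R^-1 :> R by rewrite invr_gt0.
  have b0 : 0 < N.+1%:R^-1 :> R by rewrite invr_gt0.
  move: ab; rewrite ler_pdivlMr// mulrC => ab.
  rewrite mulrDr sE; move: cxs a0 b0 ab b1 eps0.
  move: (n.+1%:R^-1) (N.+1%:R^-1) `|c - x| => a b e ce a0 b0 ab b1 eps0.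
  have t0 : 0 <= eps * a by rewrite mulr_ge0 ?ltW.
  have t1 : eps * a <= 1 by exact: le_trans ab b1.
  have h1 : eps * e <= (eps * a) * b by rewrite -mulrA ler_pM2l.
  have h2 : eps * (eps * a ^+ 2) = (eps * a) * (eps * a) by ring.
  have h3 : (eps * a) * b <= b by rewrite ler_piMl// ltW.
  have h4 : (eps * a) * (eps * a) <= eps * a by rewrite ler_piMl.
  rewrite h2; lra.
have rd : r < d by rewrite -(ltr_pM2l eps0) (le_lt_trans epsr).
have seps : eps * r <= (1 + eps) * s.
  rewrite mulrDl mul1r mulrDr lerD2r sE ler_pM2l// (le_trans cxs)//.
  by rewrite expr2 ler_pM2l ?invr_gt0.
exists r; first by rewrite r0.
have sub : ball c s `<=` ball x r.
  move=> y; rewrite /ball /= => cy.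
  have -> : x - y = (x - c) + (c - y) by ring.
  by rewrite (le_lt_trans (ler_normD _ _))// distrC ltrD2l.
have : badly_approximable eps `&` ball x r `<=` ball x r `\` ball c s.
  move=> y [by_ yr]; split => //; rewrite ball_rationalE => h.
  by have := by_ n p; rewrite leNgt h.
move=> /(le_measure lebesgue_measure) /=.
move=> le; apply: (le_trans (le _ _)).
- rewrite inE; apply: measurableI; last exact: measurable_ball.
  exact: measurable_badly_approximable.
- by rewrite inE; apply: measurableD; exact: measurable_ball.
rewrite measureD/=; [|exact: measurable_ball..|].
  rewrite (setIidr sub) (lebesgue_measure_ball _ (ltW r0)).
  rewrite (lebesgue_measure_ball _ (ltW s0)).
  rewrite -EFinB lee_fin.
  rewrite ler_pdivlMl ?addr_gt0//; rewrite -(mulr_natr r) -(mulr_natr s); lra.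
by rewrite (lebesgue_measure_ball _ (ltW r0)) ltry.
Qed.

(** By Lebesgue's theorem the density is 1 at almost every point of the set,
    whereas it stays below 1 / (1 + eps) < 1 along small radii. *)
Lemma negligible_badly_approximable (R : realType) (eps : R) :
  0 < eps -> lebesgue_measure.-negligible (badly_approximable eps).
Proof.
move=> eps0; have := lebesgue_density (measurable_badly_approximable eps).
apply: negligibleS => x bx /=; rewrite indicE mem_set//= => cvg1.
have lt1 : (1 + eps)^-1 < 1 by rewrite invf_lt1 ?ltrDl// addr_gt0.
have := cvg1 _ (nbhs_open_ereal_gt (f := fun=> (1 + eps)^-1) lt1).
move=> [/= d d0 dP].
have [r /andP[r0 rd] le] := badly_approximable_thin eps0 bx d0.
have /= := dP r; rewrite sub0r normrN gtr0_norm// => /(_ rd r0).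
rewrite (lebesgue_measure_ball _ (ltW r0)).
rewrite inver gt_eqF ?pmulrn_lgt0// => h.
have := lt_le_trans h (lee_wpmul2r _ le).
rewrite lee_fin invr_ge0 ltW ?pmulrn_lgt0// => /(_ isT).
by rewrite -EFinM mulfK ?ltxx// gt_eqF// pmulrn_lgt0.
Qed.

Lemma negligible_not_well_approximable (R : realType) :
  lebesgue_measure.-negligible (~` @well_approximable R).
Proof.
have : (@lebesgue_measure R).-negligible
    (\bigcup_k badly_approximable (k.+1%:R^-1 : R)).
  apply: negligible_bigcup => k; apply: negligible_badly_approximable.
  by rewrite invr_gt0.
apply: negligibleS => x; apply: contra_notP => h eps eps0.
pose k := Num.truncn eps^-1.
apply: contrapT => h'; apply: h; exists k => // n p.
apply: (@le_trans _ _ eps).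
  rewrite -[leRHS]invrK lef_pV2 ?posrE ?invr_gt0//.
  have epsV0 : 0 <= eps^-1 by rewrite invr_ge0 ltW.
  by have /andP[_ /ltW] := truncn_itv epsV0.
by rewrite leNgt; apply/negP => lt; apply: h'; exists n, p.
Qed.

(** Multiplying n and p by c = q (n0 + 1) gives a denominator that is large and
    divisible by q, and multiplies n |n x - p| by the constant c^2 only. *)
Lemma well_approximable_multiples (R : realType) (x : R) (q n0 : nat)
    (eps : R) :
  well_approximable x -> 0 < eps -> (0 < q)%N ->
  exists (t : nat) (p : int), (n0 <= t)%N /\
    (q * t.+1)%:R * `|(q * t.+1)%:R * x - p%:~R| < eps.
Proof.
move=> xwa eps0 q0; pose c := (q * n0.+1)%N.
have c0 : 0 < c%:R ^+ 2 :> R by rewrite exprn_gt0// ltr0n muln_gt0 q0.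
have [n [p np]] := xwa _ (divr_gt0 eps0 c0).
exists (n0.+1 * n.+1).-1, (c%:Z * p); rewrite prednK ?muln_gt0//; split.
  by rewrite -ltnS prednK ?muln_gt0// leq_pmulr.
move: np; rewrite ltr_pdivlMr//; congr (_ < _).
rewrite mulnA -/c natrM intrM -pmulrn.
have -> : c%:R * n.+1%:R * x - c%:R * p%:~R = c%:R * (n.+1%:R * x - p%:~R).
  by rewrite mulrBr mulrA.
rewrite normrM (ger0_norm (ler0n _ _)); ring.
Qed.

(** * The boundary of the partition *)
Definition bound_points (R : realType) (b : itv_bound R) : seq R :=
  if b is BSide _ x then [:: x] else [::].

Definition endpoints (R : realType) (I : interval R) : seq R :=
  let: Interval a b := I in bound_points a ++ bound_points b.

Lemma endpoint_between (R : realType) (I : interval R) (x y : R) :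
  x \in I -> y \notin I ->
  exists e, [/\ e \in endpoints I, `|x - e| <= `|x - y| & `|y - e| <= `|x - y|].
Proof.
have between (u v e : R) : u <= e <= v ->
    `|u - e| <= `|u - v| /\ `|v - e| <= `|u - v|.
  move=> /andP[ue ev]; rewrite ler0_norm ?subr_le0//.
  rewrite [`|u - v|]ler0_norm ?subr_le0 ?(le_trans ue)//.
  by rewrite ger0_norm ?subr_ge0//; split; lra.
case: I => a b; rewrite !itv_boundlr negb_and => /andP[ax xb] /orP[ay|yb].
  case: a ax ay => [c a|[]]; rewrite ?bnd_simp//.
  move=> ax ay; exists a.
  have {}ax : a <= x by case: c ax {ay}; rewrite bnd_simp// => /ltW.
  have {}ay : y <= a by case: c ay; rewrite bnd_simp -?ltNge -?leNgt// => /ltW.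
  have [|h1 h2] := between y x a; first by rewrite ay.
  by rewrite mem_cat inE eqxx distrC [`|x - y|]distrC (distrC a).
case: b xb yb => [c b|[]]; rewrite ?bnd_simp//.
move=> xb yb; exists b.
have {}xb : x <= b by case: c xb {yb}; rewrite bnd_simp// => /ltW.
have {}yb : b <= y by case: c yb; rewrite bnd_simp -?ltNge -?leNgt// => /ltW.
have [|h1 h2] := between x y b; first by rewrite xb.
by rewrite mem_cat inE eqxx orbT.
Qed.

Lemma modZDz (R : realType) (x : R) (k : int) : modZ (x + k%:~R) = modZ x.
Proof. by rewrite /modZ floorDrz ?intr_int// intrKfloor intrD; ring. Qed.

Lemma modZ_eqE (R : realType) (x y : R) :
  modZ x = modZ y -> y = x + (Num.floor y - Num.floor x)%:~R.
Proof. by rewrite /modZ intrB => e; lra. Qed.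

(** Lifting to the line: y is in the image of I exactly when some integer
    translate of y is in I, so if only x is in the arc, then I separates x + k
    from y + k for some integer k.  Working with the translates treats arcs
    through 0 and intervals of any length alike. *)
Lemma circle_arc_boundary (R : realType) (A : set R) :
  circle_arc A -> exists es : seq R, forall x y : R,
    \1_A (modZ x) != \1_A (modZ y) :> R ->
    exists2 e, e \in es & exists k : int, `|x + k%:~R - e| <= `|x - y|.
Proof.
move=> [I AE]; exists (endpoints I).
have cross x y : A (modZ x) -> ~ A (modZ y) -> exists e (k : int),
    [/\ e \in endpoints I, `|x + k%:~R - e| <= `|x - y| &
        `|y + k%:~R - e| <= `|x - y|].
  rewrite {1}AE => -[z Iz /esym/modZ_eqE]; set k := (_ - _) => zE ynA.
  have ykI : y + k%:~R \notin I.
    apply/negP => yI; apply: ynA; rewrite AE.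
    by exists (y + k%:~R); rewrite ?modZDz.
  have xkI : x + k%:~R \in I by rewrite -zE.
  have [e []] := endpoint_between xkI ykI.
  rewrite (_ : x + k%:~R - (y + k%:~R) = x - y); last by ring.
  move=> h1 h2 h3.
  by exists e, k.
move=> x y; rewrite !indicE.
have [/set_mem xA|/negP xA] := boolP (modZ x \in A);
  have [/set_mem yA|/negP yA] := boolP (modZ y \in A); rewrite ?eqxx// => _.
- have [|e [k [he hx _]]] := cross x y xA; first by move/mem_set.
  by exists e => //; exists k.
- have [|e [k [he _ hx]]] := cross y x yA; first by move/mem_set.
  by exists e => //; exists k; rewrite [`|x - y|]distrC.
Qed.

Lemma coding_boundary (R : realType) (N : nat) (J : 'I_N -> set R)
    (lambda : 'I_N -> R) :
  (forall l, circle_arc (J l)) -> exists es : seq R, forall x y : R,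
    (forall e (k : int), e \in es -> `|x - y| < `|x + k%:~R - e|) ->
    \sum_(l < N) lambda l * \1_(J l) (modZ x)
      = \sum_(l < N) lambda l * \1_(J l) (modZ y).
Proof.
move=> J_arc; have /choice[es esP] l := circle_arc_boundary (J_arc l).
exists (flatten [seq es l | l <- enum 'I_N]) => x y far.
apply: eq_bigr => l _; congr (_ * _); apply/eqP/negPn/negP => /esP[e el [k]].
apply/negP; rewrite -ltNge; apply: far.
by apply/flatten_mapP; exists l; rewrite ?mem_enum.
Qed.

(** * A criterion for infinite repetition exponents *)

(** The window |j| <= L n covers both the indices k and the indices 1 - k for
    1 <= k <= L n, so it yields L as a lower bound for both quotients. *)
Lemma rep_eqy (R : realType) (V : Type) (w : int -> V) :
  (forall L n0 : nat, exists n : nat, [/\ (n0 <= n)%N, (0 < n)%N &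
     forall j : int, `|j| <= (L * n)%:Z -> w j = w (j + n%:Z)]) ->
  rep R w = +oo%E /\ tworep R w = +oo%E.
Proof.
move=> H.
have esup_ge (A : set nat) m : A m -> (m%:R%:E <= @esup_nat R A)%E.
  by move=> Am; rewrite /esup_nat le_max; apply/orP; right;
     apply: ereal_sup_ubound; exists m.
have limsup (u : nat -> \bar R) : (forall L n0 : nat, exists2 n : nat,
    (n0 <= n)%N & (L%:R%:E <= u n)%E) -> limn_esup u = +oo%E.
  move=> Hu; apply/eqP; rewrite -leye_eq.
  apply/ereal_infP => _ [B [n0 _ nB] <-].
  rewrite leye_eq; apply/eqP/eq_infty => t.
  have [n n0n] := Hu (Num.truncn `|t|).+1 n0.
  move=> Ln; apply: (@le_trans _ _ (u n)); last first.
    by apply: ereal_sup_ubound; exists n => //; exact: nB.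
  apply: le_trans Ln; rewrite lee_fin (le_trans (ler_norm _))//.
  by have /andP[_ /ltW] := truncn_itv (normr_ge0 t).
have lower (A : set nat) L n : (0 < n)%N -> A (L * n)%N ->
    (L%:R%:E <= 1 + (n%:R^-1)%:E * @esup_nat R A)%E.
  move=> n0 /esup_ge le.
  have nR : 0 < n%:R^-1 :> R by rewrite invr_gt0 ltr0n.
  apply: (@le_trans _ _ ((n%:R^-1)%:E * ((L * n)%:R)%:E)%E).
    by rewrite -EFinM natrM mulrCA mulVf ?mulr1// pnatr_eq0 -lt0n.
  apply: (@le_trans _ _ ((n%:R^-1)%:E * @esup_nat R A)%E).
    by rewrite lee_pmul2l// ?lte_fin.
  by rewrite leeDr.
(* Asking for L + 1 keeps the repetition nonempty when L = 0. *)
split; apply: limsup => L n0; have [n [n0n n_gt0 wn]] := H L.+1 n0.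
  exists n => //; apply: (@le_trans _ _ (L.+1%:R%:E)).
    by rewrite lee_fin ler_nat.
  apply: lower => //=; rewrite muln_gt0; split => // k /andP[k1 k2].
  by apply: wn; rewrite ger0_norm// lez_nat.
exists n => //; apply: (@le_trans _ _ (L.+1%:R%:E)).
  by rewrite lee_fin ler_nat.
apply: lower => //=; rewrite muln_gt0; split => // k /andP[k1 k2]; split.
  by apply: wn; rewrite ger0_norm// lez_nat.
rewrite (wn (1 - k%:Z)); first by congr w; ring.
rewrite ler0_norm ?subr_le0// opprB; lia.
Qed.

(** * Parameters whose orbit approaches the boundary *)
Definition near_points (R : realType) (s : seq R) (d : R) : set R :=
  [set x | exists2 c, c \in s & `|x - c| <= d].

Lemma lebesgue_measure_near_points (R : realType) (s : seq R) (d : R) :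
  0 <= d -> measurable (near_points s d) /\
  (lebesgue_measure (near_points s d) <= ((size s)%:R * (d *+ 2))%:E)%E.
Proof.
move=> d0; elim: s => [|c s [ms les]].
  have -> : near_points [::] d = set0 by apply/seteqP; split => // x [].
  by split=> //; rewrite measure0 mul0r.
have -> : near_points (c :: s) d = `[c - d, c + d]%classic `|` near_points s d.
  apply/seteqP; split=> [x [c' ]|x [|[c' c's xc']]] /=.
  - rewrite inE => /predU1P[->|c's] xc; last by right; exists c'.
    by left; rewrite in_itv /= -ler_distlC distrC.
  - rewrite in_itv /= -ler_distlC distrC => xc.
    by exists c => //; rewrite inE eqxx.
  - by exists c' => //; rewrite inE c's orbT.
have mc : measurable `[c - d, c + d]%classic by exact: measurable_itv.
split; first exact: measurableU.
have h := @measureU2 _ _ _ (@lebesgue_measure R) _ _ mc ms.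
apply: (le_trans h) => {h}.
rewrite /= -natr1 mulrDl mul1r EFinD addeC leeD//.
rewrite lebesgue_measure_itv /= lte_fin.
case: ifP => _; last by rewrite lee_fin mulrn_wge0.
by rewrite -EFinD lee_fin mulr2n; lra.
Qed.

(** The pairs (beta, gamma) for which the coding may fail to repeat with shift
    n on the window |j| <= M.  Using the boundary points, rather than the coding
    itself, makes the set visibly measurable and its sections easy to
    measure. *)
Definition boundary_hit (R : realType) (es : seq R) (alpha : R)
    (M n : nat) (p : int) : set (R * R) :=
  [set z | exists (j : int) (i : nat) (k : int),
     [/\ `|j| <= M%:Z, (i < size es)%N &
      `|alpha * j%:~R ^+ 2 + z.1 * j%:~R + z.2 + k%:~R - nth 0 es i|
        <= `|n%:R * z.1 - p%:~R|]].

Lemma measurable_boundary_hit (R : realType) (es : seq R) (alpha : R)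
    (M n : nat) (p : int) : measurable (boundary_hit es alpha M n p).
Proof.
pose f (u : int * nat * int) (z : R * R) : bool :=
  ((`|u.1.1| <= M%:Z) && (u.1.2 < size es)%N) &&
  (`|alpha * u.1.1%:~R ^+ 2 + z.1 * u.1.1%:~R + z.2 + u.2%:~R - nth 0 es u.1.2|
     <= `|n%:R * z.1 - p%:~R|).
have -> : boundary_hit es alpha M n p = \bigcup_u (f u @^-1` [set true]).
  apply/seteqP; split=> [z [j [i [k [h1 h2 h3]]]]|].
    by exists (j, i, k) => //; rewrite /f /= h1 h2.
  by move=> z [[[j i] k] _ /andP[/andP[]]]; exists j, i, k.
apply: countable_bigcupT_measurable => // u.
rewrite -[_ @^-1` _]setTI.
suff m : measurable_fun setT (f u) by exact: m.
apply: measurable_and => //; apply: measurable_fun_ler.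
  apply: measurableT_comp => //.
  apply: measurable_funB => //; apply: measurable_funD => //.
  apply: measurable_funD => //; apply: measurable_funD => //.
  exact: measurable_funM.
apply: measurableT_comp => //.
by apply: measurable_funB => //; exact: measurable_funM.
Qed.

(** For fixed j and endpoint, gamma must lie within d of a class b modulo 1.
    As gamma is in [0, 1[ and d < 1, only three representatives of this class
    matter, which accounts for the factor 3. *)
Lemma boundary_hit_section_le (R : realType) (es : seq R) (alpha beta : R)
    (M n : nat) (p : int) (d := `|n%:R * beta - p%:~R|) :
  d < 1 ->
  (lebesgue_measure
     (xsection (boundary_hit es alpha M n p) beta `&` @circle R) <=
   ((M.*2.+1 * size es * 3)%:R * (d *+ 2))%:E)%E.
Proof.
move=> d1.
pose js := [seq i%:Z - M%:Z | i <- iota 0 M.*2.+1].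
pose base (j : int) (e : R) := modZ (e - alpha * j%:~R ^+ 2 - beta * j%:~R).
pose bs := [seq base j e | j <- js, e <- es].
pose s := [seq b + i | b <- bs, i <- [:: -1; 0; 1]].
have sz : size s = (M.*2.+1 * size es * 3)%N.
  by rewrite !size_allpairs size_map size_iota.
have [ms les] :=
  lebesgue_measure_near_points s (normr_ge0 (n%:R * beta - p%:~R)).
rewrite -sz; apply: le_trans les; apply: le_measure; rewrite ?inE//.
  apply: measurableI; last exact: measurable_itv.
  by apply: measurable_xsection; exact: measurable_boundary_hit.
move=> g [/xsectionP[j [i [k [jM ies]]]]] /=; rewrite -/d => hit.
rewrite /circle /= in_itv /= => /andP[g0 g1].
set b := nth 0 es i - alpha * j%:~R ^+ 2 - beta * j%:~R.
have {}hit : `|g - (modZ b + (Num.floor b - k)%:~R)| <= d.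
  move: hit; congr (`|_| <= _); rewrite /modZ intrB /b; ring.
have bP : modZ b \in bs.
  apply: (allpairs_f base); last exact: mem_nth.
  by apply/mapP; exists (absz (j + M%:Z)%R); rewrite ?mem_iota; lia.
exists (modZ b + (Num.floor b - k)%:~R) => //.
set l := Num.floor b - k in hit *.
apply: (allpairs_f +%R) => //.
have [b0 b1] := (modZ_ge0 b, modZ_lt1 b).
move: hit; rewrite ler_norml => /andP[h1 h2].
have l2 : l%:~R < (2 : int)%:~R :> R by rewrite -[2%:~R]/(2%:R); lra.
have lN2 : (-2 : int)%:~R < l%:~R :> R by rewrite mulrNz -[2%:~R]/(2%:R); lra.
rewrite !ltr_int in l2 lN2; rewrite !inE.
have : [|| l == -1, l == 0 | l == 1] by lia.
by case/or3P => /eqP ->; rewrite ?eqxx ?orbT.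
Qed.

(** * The exceptional set is null *)

(** The shifts q (t + 1) run through the positive multiples of q. *)
Definition exceptional (R : realType) (es : seq R) (alpha : R) (q L n0 : nat) :
    set (R * R) :=
  [set z | circle z.2 /\ forall (t : nat) (p : int), (n0 <= t)%N ->
     boundary_hit es alpha (L * (q * t.+1)) (q * t.+1) p z].

Lemma measurable_exceptional (R : realType) (es : seq R) (alpha : R)
    (q L n0 : nat) : measurable (exceptional es alpha q L n0).
Proof.
have -> : exceptional es alpha q L n0 = [set: R] `*` @circle R `&`
    ~` \bigcup_(u : nat * int) (if (n0 <= u.1)%N then
      ~` boundary_hit es alpha (L * (q * u.1.+1)) (q * u.1.+1) u.2 else set0).
  apply/seteqP; split=> [z [zc zh]|z [[_ zc] zh]].
    split => // -[[t p] _ /=]; case: ifP => // tn; apply; exact: zh.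
  split=> // t p tn; apply: contrapT => h; apply: zh.
  by exists (t, p) => //=; rewrite tn.
apply: measurableI.
  by apply: measurableX => //; exact: measurable_itv.
apply: measurableC; apply: countable_bigcupT_measurable => // u.
by case: ifP => _ //; apply: measurableC; exact: measurable_boundary_hit.
Qed.

(** The section lies in a set of measure at most K n d for each admissible n,
    where K depends on L and the number of endpoints only, and n d can be made
    arbitrarily small. *)
Lemma exceptional_section_null (R : realType) (es : seq R) (alpha beta : R)
    (q L n0 : nat) :
  (0 < q)%N -> well_approximable beta ->
  lebesgue_measure (xsection (exceptional es alpha q L n0) beta) = 0%E.
Proof.
move=> q0 wa; apply/eqP; rewrite -measure_le0; apply/lee_addgt0Pr => eps eps0.
rewrite add0e.
(* 6 = 3 representatives times an interval length of 2 d. *)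
pose K : R := (L.*2.+1 * size es * 6)%:R.
have K0 : 0 < K + 1 by rewrite ltr_wpDl.
have e0 : 0 < Num.min 1 (eps / (K + 1)) by rewrite lt_min ltr01 divr_gt0.
have [t [p [tn]]] := well_approximable_multiples n0 wa e0 q0.
set n := (q * t.+1)%N; set d := `|_|; rewrite lt_min => /andP[nd1 nde].
have n1 : (0 < n)%N by rewrite muln_gt0 q0.
have n1R : 1 <= n%:R :> R by rewrite ler1n.
have d0 : 0 <= d by exact: normr_ge0.
have d1 : d < 1 by apply: le_lt_trans nd1; rewrite ler_peMl.
have := @boundary_hit_section_le R es alpha beta (L * n) n p d1.
rewrite -/d => le.
have : xsection (exceptional es alpha q L n0) beta `<=`
    xsection (boundary_hit es alpha (L * n) n p) beta `&` @circle R.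
  by move=> g /xsectionP[/= gc gh]; split => //; apply/xsectionP; exact: gh.
move=> /(le_measure lebesgue_measure) le1.
apply: (le_trans (le1 _ _)).
- by rewrite inE; apply: measurable_xsection; exact: measurable_exceptional.
- rewrite inE; apply: measurableI; last exact: measurable_itv.
  by apply: measurable_xsection; exact: measurable_boundary_hit.
apply: (le_trans le); rewrite lee_fin.
have h : ((L * n).*2.+1 * size es * 3)%:R * (d *+ 2) <= K * (n%:R * d).
  rewrite -(mulr_natr d) /K mulrA (mulrC _ 2%:R) !mulrA -!natrM.
  have Ln : ((L * n).*2.+1 <= L.*2.+1 * n)%N.
    by rewrite mulSn doubleMl -add1n leq_add2r.
  rewrite ler_wpM2r// ler_nat.
  have -> : (L.*2.+1 * size es * 6 * n =
      2 * (L.*2.+1 * n * size es * 3))%N by ring.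
  by rewrite leq_mul2l /= !leq_mul.
apply: (le_trans h).
apply: (@le_trans _ _ ((K + 1) * (n%:R * d))).
  by rewrite ler_wpM2r ?lerDl// mulr_ge0.
by rewrite mulrC -ler_pdivlMr// ltW.
Qed.

(** The number q is the denominator of alpha, which makes
    alpha n (2 j + n) an integer for every multiple n of q. *)
Lemma non_exceptional_rep_eqy (R : realType) (N : nat) (J : 'I_N -> set R)
    (lambda : 'I_N -> R) (alpha : R) :
  (forall l, circle_arc (J l)) -> rational alpha ->
  exists (es : seq R) (q : nat), (0 < q)%N /\ forall z : R * R,
    circle z.2 -> ~ (\bigcup_L \bigcup_n0 exceptional es alpha q L n0) z ->
    rep R (coding J lambda alpha z.1 z.2) = +oo%E /\
    tworep R (coding J lambda alpha z.1 z.2) = +oo%E.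
Proof.
move=> /(coding_boundary lambda)[es esP] [r _ rE].
exists es, `|denq r|%N; rewrite absz_gt0 denq_neq0; split=> // -[b g] /= gc zE.
set q := `|denq r|%N in zE *.
have q0 : (0 < q)%N by rewrite absz_gt0 denq_neq0.
have aq : alpha * q%:R = (numq r)%:~R.
  rewrite -rE /q natr_absz ger0_norm ?denq_ge0// /ratr divfK//.
  by rewrite intr_eq0 denq_neq0.
apply: rep_eqy => L n0.
have [t [p [tn nohit]]] : exists (t : nat) (p : int), (n0 <= t)%N /\
    ~ boundary_hit es alpha (L * (q * t.+1)) (q * t.+1) p (b, g).
  apply: contrapT => h; apply: zE; exists L => //; exists n0 => //; split=> //.
  move=> t p tn; apply: contrapT => h'; apply: h; by exists t, p.
exists (q * t.+1)%N; split.
- by rewrite (leq_trans tn)// (leq_trans (leqnSn _))// leq_pmull.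
- by rewrite muln_gt0 q0.
move=> j jL; rewrite /coding.
set x := alpha * j%:~R ^+ 2 + b * j%:~R + g.
set n := (q * t.+1)%N in nohit jL *.
have -> : alpha * (j + n%:Z)%:~R ^+ 2 + b * (j + n%:Z)%:~R + g =
    (x + (n%:R * b - p%:~R)) +
      (numq r * t.+1%:Z * (2 * j + n%:Z) + p)%:~R.
  rewrite /x !(intrD, intrM) -aq /n !natrM; ring.
rewrite modZDz; apply: esP => e k ees.
rewrite opprD addNKr normrN ltNge; apply/negP => hit; apply: nohit.
exists j, (index e es), k; split=> //=; first by rewrite index_mem.
by rewrite nth_index.
Qed.

Theorem theorem8 (R : realType) (N : nat) (J : 'I_N -> set R)
    (lambda : 'I_N -> R) (alpha : R)
    (J_partition : partition [set: 'I_N] J (@circle R))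
    (J_arc : forall l : 'I_N, circle_arc (J l))
    (lambda_inj : injective lambda)
    (alpha_circle : circle alpha)
    (alpha_rational : rational alpha) :
  (forall beta : R, unbounded_quotients beta ->
     {ae @lebesgue_measure R, forall gamma : R, circle gamma ->
        rep R (coding J lambda alpha beta gamma) = +oo%E /\
        tworep R (coding J lambda alpha beta gamma) = +oo%E}) /\
  {ae (@lebesgue_measure R \x @lebesgue_measure R)%E, forall p : R * R,
     circle p.1 -> circle p.2 ->
     rep R (coding J lambda alpha p.1 p.2) = +oo%E /\
     tworep R (coding J lambda alpha p.1 p.2) = +oo%E}.
Proof.
have [es [q [q0 good]]] := non_exceptional_rep_eqy lambda J_arc alpha_rational.
split=> [beta /unbounded_quotients_well_approximable wa|].
  pose B L n0 := xsection (exceptional es alpha q L n0) beta.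
  have : lebesgue_measure.-negligible (\bigcup_L \bigcup_n0 B L n0).
    apply: negligible_bigcup => L; apply: negligible_bigcup => n0.
    apply/negligibleP; last exact: exceptional_section_null.
    by apply: measurable_xsection; exact: measurable_exceptional.
  apply: negligibleS => g; apply: contra_notP => gB gc.
  apply: (good (beta, g)) => // -[L _ [n0 _ ex]].
  by apply: gB; exists L => //; exists n0 => //; apply/xsectionP.
have : (@lebesgue_measure R \x @lebesgue_measure R)%E.-negligible
    (\bigcup_L \bigcup_n0 exceptional es alpha q L n0).
  apply: negligible_bigcup => L; apply: negligible_bigcup => n0.
  have mE := measurable_exceptional es alpha q L n0.
  apply/negligibleP => //.
  rewrite /= /product_measure1.
  transitivity (\int[@lebesgue_measure R]_x cst 0%E x)%E; last exact: integral0.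
  apply: ae_eq_integral => //; first exact: measurable_fun_xsection.
  have := negligible_not_well_approximable R.
  apply: negligibleS => b; apply: contra_not.
  by move=> wa _; exact: exceptional_section_null.
apply: negligibleS => z; apply: contra_notP => gB _ gc.
exact: good.
Qed.
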